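(* Let $0\le\ell<u$ and $n\ge 2$. Among all $\boldsymbol\xi=(\xi_0,\xi_1,\ldots,\xi_n)$ with $\ell=\xi_0<\xi_1<\cdots<\xi_{n-1}<\xi_n=u$, the unique minimizer of $\operatorname{vol}(\breve{U}^*_2(\boldsymbol\xi))$ is given by $\xi_i=\ell+\frac{i}{n}(u-\ell)$ for $i=1,\ldots,n-1$, and the minimum volume is $$\frac{1}{18}(u-\ell)^3+\frac{(u-\ell)^3}{36n^2}.$$
   Context: Let $f(x):=x^2$ on $[\ell,u]$. Given $\boldsymbol\xi$ with $\ell=\xi_0<\cdots<\xi_n=u$, put $\tau_0:=\ell$, $\tau_{n+1}:=u$ and, for $i=1,\ldots,n$, $$\tau_i:=\frac{[f(\xi_i)-f'(\xi_i)\xi_i]-[f(\xi_{i-1})-f'(\xi_{i-1})\xi_{i-1}]}{f'(\xi_{i-1})-f'(\xi_i)},$$ the abscissa of the intersection of the tangent lines to $f$ at $\xi_{i-1}$ and $\xi_i$. Let $g:[\ell,u]\to\mathbb{R}$ be the piecewise-linear function whose graph connects, in order, $(\ell,f(\ell))$, the points $(\tau_i,\ f(\xi_i)+f'(\xi_i)(\tau_i-\xi_i))$ for $i=1,\ldots,n$, and $(u,f(u))$. With $s:=\frac{f(u)-f(\ell)}{u-\ell}$, the set $\breve{U}^*_2(\boldsymbol\xi)$ is the closure of the convex hull of $$\left\{(x,y,z)\in\mathbb{R}^3:\ (f(\ell)-s\ell)z+sx\ge y\ge z\,g(x/z),\ uz\ge x\ge \ell z,\ 1\ge z>0,\ y\ge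 0\right\}.$$ $\operatorname{vol}$ denotes 3-dimensional volume. *)

(* Defs.v *)
From HB Require Import structures.
From mathcomp Require Import all_boot all_order all_algebra.
From mathcomp Require Import all_classical all_reals all_analysis.

Set Implicit Arguments.
Unset Strict Implicit.
Unset Printing Implicit Defensive.

Import Order.TTheory GRing.Theory Num.Theory numFieldNormedType.Exports.

Local Open Scope classical_set_scope.
Local Open Scope ring_scope.

(* A tuple xi : n.+1.-tuple R lists the points xi`_0, ..., xi`_n. *)
Definition subdivision (R : realType) (n : nat) (l u : R)
    (xi : n.+1.-tuple R) : Prop :=
  [/\ xi`_0 = l, xi`_n = u & sorted <%R xi].

Definition uniform_subdivision (R : realType) (n : nat) (l u : R) :
    n.+1.-tuple R :=
  [tuple l + i%:R / n%:R * (u - l) | i < n.+1].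

(* Meaningful for 1 <= i <= n only, since i.-1 = 0 for i = 0. *)
Definition tau (R : realType) (n : nat) (f : R -> R) (xi : n.+1.-tuple R)
    (i : nat) : R :=
  ((f xi`_i - derive1 f xi`_i * xi`_i)
     - (f xi`_i.-1 - derive1 f xi`_i.-1 * xi`_i.-1))
  / (derive1 f xi`_i.-1 - derive1 f xi`_i).

(* The function whose graph is the polygonal line through the points p :: s,
   whose abscissas are meant to be increasing. Only its values between the
   first and the last abscissa matter. *)
Fixpoint polyline (R : realType) (p : R * R) (s : seq (R * R)) (x : R) : R :=
  if s is q :: s' then
    if x <= q.1 then p.2 + (q.2 - p.2) / (q.1 - p.1) * (x - p.1)
    else polyline q s' x
  else p.2.

Definition tangent_polyline (R : realType) (n : nat) (l u : R) (f : R -> R)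
    (xi : n.+1.-tuple R) : R -> R :=
  polyline (l, f l)
    (rcons [seq (tau f xi i, f xi`_i + derive1 f xi`_i * (tau f xi i - xi`_i))
           | i <- iota 1 n]
       (u, f u)).

(* R^o is R seen as a vector space over itself, with the usual topology. *)
Definition convex_hull (R : realType) (A : set (R^o * R^o * R^o)) :
    set (R^o * R^o * R^o) :=
  smallest (@convex_set R (R^o * R^o * R^o)%type) A.

Definition Ustar (R : realType) (n : nat) (l u : R) (f : R -> R)
    (xi : n.+1.-tuple R) : set (R^o * R^o * R^o) :=
  let s := (f u - f l) / (u - l) in
  let g := tangent_polyline l u f xi in
  closure (convex_hull [set p : R^o * R^o * R^o |
    let: (x, y, z) := (p : R * R * R) in
    [/\ z * g (x / z) <= y <= (f l - s * l) * z + s * x,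
        l * z <= x <= u * z,
        0 < z <= 1
      & 0 <= y]]).

Definition volume (R : realType) (A : set (R * R * R)) : \bar R :=
  ((lebesgue_measure \x lebesgue_measure) \x lebesgue_measure)%E A.

Definition Ustar2_volume (R : realType) (n : nat) (l u : R)
    (xi : n.+1.-tuple R) : \bar R :=
  volume (Ustar l u (fun x => x ^+ 2) xi).

(* Main.v *)
Require Import Defs.
From HB Require Import structures.
From mathcomp Require Import all_boot all_order all_algebra.
From mathcomp Require Import all_classical all_reals all_analysis.
From mathcomp Require Import measurable_realfun ring lra.

Set Implicit Arguments.
Unset Strict Implicit.
Unset Printing Implicit Defensive.

Import Order.TTheory GRing.Theory Num.Theory numFieldNormedType.Exports.

Local Open Scope classical_set_scope.
Local Open Scope ring_scope.

(** The tangent line to the parabola at [b] lies [(x - b) ^+ 2] below it, so the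
polygonal line [g] built from the tangents at the points of the subdivision is
their pointwise maximum ([polyline_envelope]); in particular [g] is convex.
Hence the set whose closed convex hull is taken is already the cone over the
convex polygon between [g] and the chord, cut at height 1 and missing only its
apex; being described by finitely many affine inequalities, the cone with its
apex is closed and convex, so it is the closed convex hull ([Ustar_square]).

Its slice at height [z] is the polygon scaled by [z], of area [z ^+ 2 * K], so
that its volume is [K / 3] by Fubini.  The area [K] is the area
[(u - l) ^+ 3 / 6] between chord and parabola plus the area between parabola
and [g], which is the integral of the squared distance to the nearest point of
the subdivision: each gap [h] contributes [h ^+ 3 / 12].  This gives
[cut_cone_volume], where the subdivision enters only through the sum of the
cubes of its gaps.

The gaps have a fixed sum [n * d] with [d := (u - l) / n].  Since
[h ^+ 3 - (3 * d ^+ 2 * h - 2 * d ^+ 3) = (h - d) ^+ 2 * (h + 2 * d)] is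
nonnegative and vanishes only at [h = d], the sum of the cubes is at least
[n * d ^+ 3], with equality exactly for the uniform subdivision
([gap_cubes_leif]). *)

(** * The tangent envelope of the parabola *)

(** The tangent to the parabola at [b], homogenized: [z * tangent b 1 (x / z)] for
[z > 0], but also meaningful at the apex [z = 0]. *)
Definition tangent (R : realType) (b z x : R) : R := 2 * b * x - b ^+ 2 * z.

Fixpoint envelope (R : realType) (a : R) (r : seq R) (z x : R) : R :=
  if r is b :: r' then Num.max (tangent a z x) (envelope b r' z x)
  else tangent a z x.

Lemma envelope_le (R : realType) (a : R) r (z x y : R) :
  (envelope a r z x <= y) = all (fun b => tangent b z x <= y) (a :: r).
Proof.
elim: r a => [|b r IH] a /=; first by rewrite andbT.
by rewrite ge_max IH.
Qed.

Lemma tangent_scale (R : realType) (b z x : R) : 0 < z ->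
  z * tangent b 1 (x / z) = tangent b z x.
Proof. by move=> z0; rewrite /tangent; field; rewrite gt_eqF. Qed.

Lemma envelope_scale (R : realType) (a : R) r (z x : R) : 0 < z ->
  z * envelope a r 1 (x / z) = envelope a r z x.
Proof.
move=> z0; elim: r a => [|b r IH] a /=; first exact: tangent_scale.
by rewrite maxr_pMr ?ltW// tangent_scale// IH.
Qed.

Lemma tangent_cross (R : realType) (a b z x : R) : a < b ->
  (tangent b z x <= tangent a z x) = (x <= (a + b) / 2 * z).
Proof.
move=> ab; rewrite -subr_ge0.
have -> : tangent a z x - tangent b z x
  = (b - a) * 2 * ((a + b) / 2 * z - x) by rewrite /tangent; field.
by rewrite pmulr_rge0 ?subr_ge0// mulr_gt0// subr_gt0.
Qed.

(** Before the midpoint of the first gap the first tangent dominates: the later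
ones only overtake it at midpoints further to the right. *)
Lemma envelope_left (R : realType) (a b : R) r (z x : R) :
  0 <= z -> path <%R a (b :: r) -> x <= (a + b) / 2 * z ->
  envelope a (b :: r) z x = tangent a z x.
Proof.
move=> z0 /= /andP[ab br] xab; apply/max_idPl.
rewrite envelope_le; apply/allP => c cbr.
have bc : b <= c.
  move: cbr; rewrite inE => /predU1P[->//|cr].
  by rewrite ltW// (allP (order_path_min lt_trans br)).
rewrite tangent_cross; last exact: lt_le_trans ab bc.
by rewrite (le_trans xab)// ler_wpM2r//; lra.
Qed.

Lemma envelope_right (R : realType) (a b : R) r (z x : R) :
  a < b -> (a + b) / 2 * z <= x ->
  envelope a (b :: r) z x = envelope b r z x.
Proof.
move=> ab xab; apply/max_idPr; apply: (@le_trans _ _ (tangent b z x)).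
  have -> : tangent b z x = tangent a z x + (b - a) * 2 * (x - (a + b) / 2 * z).
    by rewrite /tangent; field.
  by rewrite lerDl !mulr_ge0// ?subr_ge0// ltW.
have := lexx (envelope b r z x).
by rewrite envelope_le => /allP; apply; rewrite mem_head.
Qed.

(** Starting anywhere on the first tangent before the first midpoint, instead of at
[a] itself, lets the induction restart from each vertex of the line. *)
Lemma polyline_envelope (R : realType) (t a : R) r (x : R) :
  path <%R a r -> t < (if r is b :: _ then (a + b) / 2 else a) ->
  t <= x <= last a r ->
  polyline (t, tangent a 1 t)
    (rcons (pairmap (fun a b => ((a + b) / 2, a * b)) a r)
       (last a r, last a r ^+ 2)) x = envelope a r 1 x.
Proof.
elim: r t a => [|b r IH] t a /=.
  move=> _ ta /andP[tx xa]; rewrite xa /tangent; field.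
  by apply: lt0r_neq0; lra.
move=> /andP[ab br] tab /andP[tx xl].
case: ifPn => [xab|]; last rewrite -ltNge => xab.
  rewrite -/(envelope a (b :: r) 1 x) envelope_left ?mulr1 /= ?ab//.
  rewrite /tangent; field.
  by apply: lt0r_neq0; lra.
rewrite -/(envelope a (b :: r) 1 x) envelope_right ?mulr1 ?(ltW xab)//.
rewrite -(IH ((a + b) / 2) b) ?(ltW xab)//.
  by rewrite (_ : tangent b 1 ((a + b) / 2) = a * b)// /tangent; field.
case: r br {IH xl} => [_|c r /= /andP[bc _]]; lra.
Qed.

Lemma map_iota_pairmap (R S : Type) (x0 : R) (F : R -> R -> S) (a : R) r :
  [seq F (nth x0 (a :: r) i.-1) (nth x0 (a :: r) i) | i <- iota 1 (size r)]
  = pairmap F a r.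
Proof.
elim: r a => [//|b r IH] a /=; congr cons.
rewrite -IH (iotaDl 1 1) -map_comp; apply/eq_in_map => i.
by rewrite mem_iota => /andP[i1 _] /=; case: i i1.
Qed.

(** * Sums of cubes of gaps *)

Fixpoint gap_cubes (R : realType) (a : R) (r : seq R) : R :=
  if r is b :: r' then (b - a) ^+ 3 + gap_cubes b r' else 0.

(** The left-hand side sums [3 * d ^+ 2 * h - 2 * d ^+ 3] over the gaps [h]: the
tangent at [d] to [h ^+ 3], which is strictly convex for positive [h]. *)
Lemma gap_cubes_leif (R : realType) (a : R) r (d : R) :
  0 < d -> path <%R a r ->
  3 * d ^+ 2 * (last a r - a) - 2 * (size r)%:R * d ^+ 3 <= gap_cubes a r
   ?= iff path (fun x y => y == x + d) a r.
Proof.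
move=> d0; elim: r a => [|b r IH] a /=.
  by move=> _; rewrite subrr !mulr0 mul0r subr0; exact/leif_refl.
move=> /andP[ab /IH {}IH].
have step : 3 * d ^+ 2 * (b - a) - 2 * d ^+ 3 <= (b - a) ^+ 3
    ?= iff (b == a + d).
  have -> : (b - a) ^+ 3 = 3 * d ^+ 2 * (b - a) - 2 * d ^+ 3
      + (b - a - d) ^+ 2 * (b - a + 2 * d) by ring.
  have hpos : 0 < b - a + 2 * d by lra.
  split; first by rewrite lerDl mulr_ge0 ?sqr_ge0 ?ltW.
  rewrite -[X in X == _]addr0 (inj_eq (addrI _)) eq_sym.
  rewrite mulf_eq0 (gt_eqF hpos) orbF.
  by rewrite sqrf_eq0 -addrA -opprD subr_eq0.
have := leifD step IH; congr (_ <= _ ?= iff _).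
by rewrite -natr1; ring.
Qed.

Lemma path_arith (R : realType) (a d : R) r :
  path (fun x y => y == x + d) a r =
  (r == [seq a + i%:R * d | i <- iota 1 (size r)]).
Proof.
elim: r a => [//|b r IH] a /=.
rewrite eqseq_cons mul1r; case: eqP => //= ->; rewrite IH.
congr (_ == _); rewrite (iotaDl 1 1) -map_comp; apply/eq_map => i /=.
by rewrite natrD mulrDl mul1r addrA.
Qed.

(** * Area between a line and the envelope *)

Lemma integral_deriv_horner (R : realType) (P : {poly R}) (p q : R) : p <= q ->
  (\int[lebesgue_measure]_(x in `[p, q]) (P^`().[x])%:E = (P.[q] - P.[p])%:E)%E.
Proof.
rewrite le_eqVlt => /predU1P[->|pq].
  by rewrite set_itv1 integral_set1 subrr.
rewrite (@continuous_FTC2 _ _ (horner P)) ?EFinB//.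
- by apply: continuous_subspaceT; exact: continuous_horner.
- split.
  + by move=> x _; exact: derivable_horner.
  + by apply: cvg_at_right_filter; exact: continuous_horner.
  + by apply: cvg_at_left_filter; exact: continuous_horner.
- by move=> x _; rewrite derivE.
Qed.

Lemma measurable_envelope (R : realType) (a : R) r (z : R) :
  measurable_fun setT (envelope a r z).
Proof.
have mt b : measurable_fun setT (tangent b z).
  by apply: measurable_funB => //; exact: measurable_funM.
by elim: r a => [|b r IH] a /=; [exact: mt|exact: measurable_maxr].
Qed.

Lemma integral_itv_cat (R : realType) (f : R -> \bar R) (p m q : R) :
  p <= m -> m <= q -> measurable_fun setT f ->
  (forall x : R, p <= x <= q -> (0 <= f x)%E) ->
  (\int[lebesgue_measure]_(x in `[p, q]) f x =
   \int[lebesgue_measure]_(x in `[p, m]) f x +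
   \int[lebesgue_measure]_(x in `[m, q]) f x)%E.
Proof.
move=> pm mq mf f0.
have E : `[p, q]%classic = `[p, m[ `|` `[m, q] :> set R.
  by rewrite -itv_bndbnd_setU ?bnd_simp.
rewrite E ge0_integral_setU//.
- by rewrite integral_itv_bndo_bndc//; exact: measurable_funTS.
- exact: measurable_funTS.
- by move=> x; rewrite -E /= in_itv; exact: f0.
- apply/disj_setPLR => x /=; rewrite !in_itv/= => /andP[_ xm] /andP[mx _].
  by move: xm; rewrite ltNge mx.
Qed.

Lemma integral_tangent_gap (R : realType) (al be b z p q : R) : p <= q ->
  (\int[lebesgue_measure]_(x in `[p, q]) (al * x + be - tangent b z x)%:E =
   ((al - 2 * b) * (q ^+ 2 - p ^+ 2) / 2 + (be + b ^+ 2 * z) * (q - p))%:E)%E.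
Proof.
move=> pq.
pose P : {poly R} := ((al - 2 * b) / 2) *: 'X^2 + (be + b ^+ 2 * z) *: 'X.
transitivity (\int[lebesgue_measure]_(x in `[p, q]) (P^`().[x])%:E)%E.
  apply: eq_integral => x _; congr _%:E.
  by rewrite /P derivD !derivZ derivXn derivX !hornerE /tangent /=; field.
by rewrite integral_deriv_horner//; congr _%:E; rewrite /P !hornerE /=; field.
Qed.

(** The right-hand side comes from writing the tangent at [b] as
[x ^+ 2 - (x - b) ^+ 2]: after scaling by [z], the envelope is [x ^+ 2] minus the
squared distance to the nearest node.  That squared distance integrates to
[h ^+ 3 / 12] over a gap [h], and to [(a - t) ^+ 3 / 3] over the incomplete
stretch from [t] to the first node, where [t] may be the midpoint of the
previous gap. *)
Lemma integral_envelope_gap (R : realType) (al be t a : R) r (z : R) :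
  0 <= z -> path <%R a r -> t <= (if r is b :: _ then (a + b) / 2 else a) ->
  (forall x, t * z <= x <= last a r * z ->
     envelope a r z x <= al * x + be * z) ->
  (\int[lebesgue_measure]_(x in `[(t * z)%R, (last a r * z)%R])
     (al * x + be * z - envelope a r z x)%:E =
   (z ^+ 2 * (al * (last a r ^+ 2 - t ^+ 2) / 2 + be * (last a r - t)
     - (last a r ^+ 3 - t ^+ 3) / 3 + (a - t) ^+ 3 / 3
     + gap_cubes a r / 12))%:E)%E.
Proof.
move=> z0; elim: r t a => [|b r IH] t a.
  move=> _ ta _ /=; rewrite integral_tangent_gap; last exact: ler_wpM2r.
  by congr _%:E; field.
move=> abr tab Egap; have /= /andP[ab br] := abr.
set m := (a + b) / 2 in tab.
have bl : b <= last b r.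
  by case: r br {IH Egap abr} => [//|c r] /(order_path_min lt_trans)
    /allP/(_ (last b (c :: r))) /= /(_ (mem_last _ _)) /ltW.
have mz : t * z <= m * z by exact: ler_wpM2r.
have ml : m <= last b r by rewrite /m; lra.
have mlz : m * z <= last b r * z by exact: ler_wpM2r.
rewrite (@integral_itv_cat _ _ _ (m * z))//; last 2 first.
- apply/measurable_EFinP; apply: measurable_funB.
    by apply: measurable_funD => //; exact: measurable_funM.
  exact: (measurable_envelope a (b :: r)).
- by move=> x xtl; rewrite lee_fin subr_ge0 Egap.
rewrite [X in (X + _)%E](_ : _ =
  (\int[lebesgue_measure]_(x in `[(t * z)%R, (m * z)%R])
     (al * x + be * z - tangent a z x)%:E)%E); last first.
  apply: eq_integral => x; rewrite inE/= in_itv/= => /andP[_ xm].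
  by rewrite -/(envelope a (b :: r) z x) envelope_left.
rewrite integral_tangent_gap// [X in (_ + X)%E](_ : _ =
  (\int[lebesgue_measure]_(x in `[(m * z)%R, (last b r * z)%R])
     (al * x + be * z - envelope b r z x)%:E)%E); last first.
  apply: eq_integral => x; rewrite inE/= in_itv/= => /andP[mx _].
  by rewrite -/(envelope a (b :: r) z x) envelope_right.
rewrite IH//.
- by rewrite -EFinD; congr _%:E; rewrite /m; field.
- by case: r br {IH Egap abr bl ml mlz} => [_|c r /= /andP[bc _]];
    rewrite /m; lra.
- move=> x /andP[mx xl]; rewrite -(@envelope_right _ a)//.
  by apply: Egap; rewrite xl (le_trans mz mx).
Qed.

(** * The cone as a finite intersection of half-spaces *)

Definition halfspace (R : realType) (c : R * R * R * R) : set (R * R * R) :=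
  [set p | 0 <= c.1.1.1 * p.1.1 + c.1.1.2 * p.1.2 + c.1.2 * p.2 + c.2].

Lemma closed_halfspace (R : realType) (c : R * R * R * R) :
  closed (halfspace c : set (R^o * R^o * R^o)).
Proof.
pose f (p : R^o * R^o * R^o) : R^o :=
  c.1.1.1 * p.1.1 + c.1.1.2 * p.1.2 + c.1.2 * p.2 + c.2.
have cf : continuous f.
  move=> p; apply: cvgD; last exact: cvg_cst.
  have c1 : (fun p : R^o * R^o * R^o => p.1.1) @ p --> p.1.1.
    by apply: (@cvg_comp _ _ _ fst fst); [exact: cvg_fst|exact: cvg_fst].
  have c2 : (fun p : R^o * R^o * R^o => p.1.2) @ p --> p.1.2.
    by apply: (@cvg_comp _ _ _ fst snd); [exact: cvg_fst|exact: cvg_snd].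
  apply: cvgD; last by apply: cvgM; [exact: cvg_cst|exact: cvg_snd].
  by apply: cvgD; apply: cvgM => //; exact: cvg_cst.
have -> : halfspace c = f @^-1` [set x : R^o | 0 <= x] by [].
move/continuous_closedP : cf; apply.
exact: closed_ge.
Qed.

Lemma measurable_halfspace (R : realType) (c : R * R * R * R) :
  measurable (halfspace c).
Proof.
rewrite -[halfspace c]setTI; apply: measurable_fun_le => //.
have m1 : measurable_fun setT (fun p : R * R * R => p.1.1).
  exact: (measurableT_comp measurable_fst measurable_fst).
have m2 : measurable_fun setT (fun p : R * R * R => p.1.2).
  exact: (measurableT_comp measurable_snd measurable_fst).
apply: measurable_funD => //; apply: measurable_funD; last first.
  by apply: measurable_funM => //; exact: measurable_snd.
by apply: measurable_funD; exact: measurable_funM.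
Qed.

Lemma convex_halfspace (R : realType) (c : R * R * R * R) :
  @convex_set R (R^o * R^o * R^o)%type (halfspace c).
Proof.
move=> p q k; rewrite !inE /halfspace /= => hp hq.
set v := (X in 0 <= X).
have -> : v =
  k%:num * (c.1.1.1 * p.1.1 + c.1.1.2 * p.1.2 + c.1.2 * p.2 + c.2) +
  (1 - k%:num) * (c.1.1.1 * q.1.1 + c.1.1.2 * q.1.2 + c.1.2 * q.2 + c.2).
  by rewrite /v /conv /= /unstable.onem /GRing.scale /=; ring.
by rewrite addr_ge0 ?mulr_ge0// subr_ge0.
Qed.

(** The chord of the parabola over [[a, last a r]] has slope [a + last a r] and
intercept [- (a * last a r)]. *)
Definition cut_cone (R : realType) (a : R) (r : seq R) : set (R * R * R) :=
  [set p | [/\ a * p.2 <= p.1.1 <= last a r * p.2, 0 <= p.2 <= 1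
    & envelope a r p.2 p.1.1 <= p.1.2
        <= (a + last a r) * p.1.1 - a * last a r * p.2]].

Definition cut_cone_facets (R : realType) (a : R) (r : seq R)
  : seq (R * R * R * R) :=
  [:: (1, 0, - a, 0); (-1, 0, last a r, 0); (0, 0, 1, 0); (0, 0, -1, 1);
      (a + last a r, -1, - (a * last a r), 0)]
  ++ [seq (- (2 * b), 1, b ^+ 2, 0) | b <- a :: r].

Lemma cut_coneE (R : realType) (a : R) (r : seq R) :
  cut_cone a r = \bigcap_(c in [set` cut_cone_facets a r]) halfspace c.
Proof.
apply/seteqP; split => [[[x y] z]|].
  rewrite /cut_cone /= => -[/andP[x1 x2] /andP[z1 z2] /andP[Ey yc]] c /=.
  rewrite /cut_cone_facets mem_cat.
  case/orP; last first.
    move=> /mapP[b br ->]; rewrite /halfspace /=.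
    move: Ey; rewrite envelope_le => /allP/(_ _ br) /=.
    rewrite /tangent => h; lra.
  rewrite !inE => /orP[/eqP->|/orP[/eqP->|/orP[/eqP->|/orP[/eqP->|/eqP->]]]];
    rewrite /halfspace /=; lra.
move=> [[x y] z] h; rewrite /cut_cone /=.
have facet c : c \in cut_cone_facets a r -> halfspace c (x, y, z) by exact: h.
have := facet _ (mem_nth 0 (isT : 0 < size (cut_cone_facets a r))%N).
have := facet _ (mem_nth 0 (isT : 1 < size (cut_cone_facets a r))%N).
have := facet _ (mem_nth 0 (isT : 2 < size (cut_cone_facets a r))%N).
have := facet _ (mem_nth 0 (isT : 3 < size (cut_cone_facets a r))%N).
have := facet _ (mem_nth 0 (isT : 4 < size (cut_cone_facets a r))%N).
rewrite /halfspace /= => h4 h3 h2 h1 h0.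
split; [by apply/andP; split; lra..|apply/andP; split; last by lra].
rewrite envelope_le; apply/allP => b br.
have := facet (- (2 * b), 1, b ^+ 2, 0).
rewrite mem_cat map_f// orbT => /(_ isT).
by rewrite /halfspace /tangent /= => ?; lra.
Qed.

Lemma closed_cut_cone (R : realType) (a : R) (r : seq R) :
  closed (cut_cone a r : set (R^o * R^o * R^o)).
Proof.
by rewrite cut_coneE; apply: closed_bigI => c _; exact: closed_halfspace.
Qed.

Lemma convex_cut_cone (R : realType) (a : R) (r : seq R) :
  @convex_set R (R^o * R^o * R^o)%type (cut_cone a r).
Proof.
rewrite cut_coneE => p q k; rewrite !inE => hp hq c hc.
have := @convex_halfspace _ c p q k; rewrite !inE.
by apply; [exact: hp|exact: hq].
Qed.

Lemma measurable_cut_cone (R : realType) (a : R) (r : seq R) :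
  measurable (cut_cone a r).
Proof.
rewrite cut_coneE; apply: fin_bigcap_measurable; first exact: finite_seq.
by move=> c _; exact: measurable_halfspace.
Qed.

(** The gap between chord and tangent is affine, so its sign is read off at the two
endpoints, where it is [z * (a - b) ^+ 2] and [z * (last a r - b) ^+ 2]. *)
Lemma envelope_le_chord (R : realType) (a : R) r (z x : R) :
  0 <= z -> path <%R a r -> a * z <= x <= last a r * z ->
  envelope a r z x <= (a + last a r) * x - a * last a r * z.
Proof.
move=> z0 ar /andP[ax xl]; rewrite envelope_le; apply/allP => b br.
case: r ar br xl => [_|c r ar _ xl].
  rewrite inE => /eqP-> /= xa; have -> : x = a * z by apply/le_anti/andP.
  by rewrite /tangent le_eqVlt; apply/orP; left; apply/eqP; ring.
have al : 0 < last a (c :: r) - a.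
  have /allP/(_ (last c r)) := order_path_min lt_trans ar.
  by rewrite mem_last subr_gt0; apply.
rewrite -subr_ge0 -(pmulr_rge0 _ al); set l := last _ _ in xl al *.
rewrite [X in 0 <= X](_ : _ =
  (l * z - x) * (a - b) ^+ 2 + (x - a * z) * (l - b) ^+ 2).
  by rewrite addr_ge0// mulr_ge0 ?sqr_ge0 ?subr_ge0.
by rewrite /tangent; ring.
Qed.

(** * Its volume *)

Lemma sigma_finite_product d1 d2 (T1 : measurableType d1)
    (T2 : measurableType d2) (R : realType)
    (m1 : {sigma_finite_measure set T1 -> \bar R})
    (m2 : {sigma_finite_measure set T2 -> \bar R}) :
  sigma_finite setT (m1 \x m2)%E.
Proof.
have /sigma_finiteP[F [FT Fnd Ffin]] := sigma_finiteT m1.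
have /sigma_finiteP[G [GT Gnd Gfin]] := sigma_finiteT m2.
exists (fun n => F n `*` G n).
  apply/seteqP; split => // -[x y] _.
  have [i _ Fx] : (\bigcup_n F n) x by rewrite -FT.
  have [j _ Gy] : (\bigcup_n G n) y by rewrite -GT.
  exists (maxn i j) => //; split => /=.
    by have /subsetPset := Fnd _ _ (leq_maxl i j); apply.
  by have /subsetPset := Gnd _ _ (leq_maxr i j); apply.
move=> n; have [mF Fn] := Ffin n; have [mG Gn] := Gfin n.
split; first exact: measurableX.
by rewrite product_measure1E// lte_mul_pinfty// ge0_fin_numE.
Qed.

(** Naming the planar Lebesgue measure lets it carry its own sigma-finite
structure, which slicing the space by the last coordinate requires. *)
Definition plane_measure (R : realType) :
    set (measurableTypeR R * measurableTypeR R)%type -> \bar R :=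
  (lebesgue_measure \x lebesgue_measure)%E.

HB.instance Definition _ (R : realType) := Measure.on (@plane_measure R).
HB.instance Definition _ (R : realType) :=
  Measure_isSigmaFinite.Build _ _ _ (@plane_measure R)
    (sigma_finite_product lebesgue_measure lebesgue_measure).

Lemma product_measure_ysection d1 d2 (T1 : measurableType d1)
    (T2 : measurableType d2) (R : realType)
    (m1 : {sigma_finite_measure set T1 -> \bar R})
    (m2 : {sigma_finite_measure set T2 -> \bar R}) (A : set (T1 * T2)) :
  measurable A ->
  ((m1 \x m2) A = \int[m2]_y m1 (ysection A y))%E.
Proof.
move=> mA.
rewrite (@product_measure_unique _ _ _ _ _ m1 m2 (m1 \x^ m2)%E _ A mA)//.
by move=> B C mB mC; exact: product_measure2E.
Qed.

Lemma volume_slices (R : realType) (A : set (R * R * R)) : measurable A ->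
  volume A = (\int[lebesgue_measure]_z plane_measure (ysection A z))%E.
Proof.
move=> mA.
exact: (product_measure_ysection (@plane_measure R) lebesgue_measure mA).
Qed.

Lemma cut_cone_volume (R : realType) (a : R) (r : seq R) : path <%R a r ->
  volume (cut_cone a r) =
  (1 / 18%:R * (last a r - a) ^+ 3 + gap_cubes a r / 36%:R)%:E.
Proof.
move=> ar; set l := last a r.
have mcut := measurable_cut_cone a r.
rewrite volume_slices//.
(* K is the area of the slice at height 1. *)
pose K := (l - a) ^+ 3 / 6 + gap_cubes a r / 12.
have slice z : 0 <= z <= 1 ->
  plane_measure (ysection (cut_cone a r) z) = (z ^+ 2 * K)%:E.
  move=> z01; have /andP[z0 _] := z01.
  have sectionP x y :
      xsection (ysection (cut_cone a r) z) x y <-> cut_cone a r (x, y, z).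
    by rewrite /xsection /ysection /= !inE /= inE.
  rewrite /plane_measure /product_measure1 /=.
  transitivity (\int[lebesgue_measure]_(x in `[(a * z)%R, (l * z)%R])
     ((a + l) * x + - (a * l) * z - envelope a r z x)%:E)%E.
    rewrite [RHS]integral_mkcond; apply: eq_integral => x _ /=.
    rewrite patchE; case: ifPn; rewrite ?notin_setE ?inE /= ?in_itv/= => xI.
      rewrite (_ : xsection _ _ = `[envelope a r z x,
          (a + l) * x - a * l * z]%classic); last first.
        apply/seteqP; split=> y; rewrite /= in_itv/=.
          by move=> /sectionP[].
        by move=> yI; apply/sectionP; split.
      have := envelope_le_chord z0 ar xI; rewrite -/l => Ec.
      rewrite lebesgue_measure_itv /= lte_fin mulNr.
      move: Ec; rewrite le_eqVlt => /predU1P[->|Ec]; first by rewrite ltxx subrr.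
      by rewrite Ec EFinB.
    rewrite (_ : xsection _ _ = set0) ?measure0//.
    by apply/seteqP; split => // y /sectionP[/= /xI].
  rewrite integral_envelope_gap//.
  - by rewrite -/l /K; congr _%:E; field.
  - by case: (r) (ar) => [_|b s /= /andP[ab _]]; lra.
  - by move=> x xI; rewrite -/l mulNr; exact: envelope_le_chord.
transitivity (\int[lebesgue_measure]_(z in `[0%R, 1%R]) (z ^+ 2 * K)%:E)%E.
  rewrite [RHS]integral_mkcond; apply: eq_integral => z _ /=.
  rewrite patchE; case: ifPn; rewrite ?notin_setE ?inE /= ?in_itv/=.
    exact: slice.
  move=> z01; rewrite (_ : ysection _ _ = set0) ?measure0//.
  by apply/seteqP; split => // -[x y]; rewrite /ysection /= inE => -[].
pose P : {poly R} := (K / 3) *: 'X^3.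
transitivity (\int[lebesgue_measure]_(z in `[0%R, 1%R]) (P^`().[z])%:E)%E.
  apply: eq_integral => z _; congr _%:E.
  by rewrite /P derivZ derivXn !hornerE /=; field.
rewrite integral_deriv_horner//; congr _%:E.
by rewrite /P /K !hornerE /=; field.
Qed.

(** * Identification of the closed convex hull *)

Lemma derive1_square (R : realType) (x : R) :
  derive1 (fun y : R => y ^+ 2) x = 2 * x.
Proof. by rewrite exp_derive1. Qed.

Lemma tau_square (R : realType) (n : nat) (xi : n.+1.-tuple R) (i : nat) :
  xi`_i.-1 < xi`_i -> tau (fun x => x ^+ 2) xi i = (xi`_i.-1 + xi`_i) / 2.
Proof.
move=> lt_xi; rewrite /tau !derive1_square; field.
by apply: ltr0_neq0; lra.
Qed.

Lemma subdivisionP (R : realType) (n : nat) (l u : R) (xi : n.+1.-tuple R) :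
  subdivision l u xi ->
  exists r, [/\ xi = l :: r :> seq R, path <%R l r, last l r = u & size r = n].
Proof.
case: xi => -[//|a r] /= sr [/= <- <- ar]; exists r.
move/eqP: sr => [sr]; split => //.
by rewrite -sr (nth_last 0 (a :: r)).
Qed.

Lemma tangent_polyline_square (R : realType) (n : nat) (l u : R)
    (xi : n.+1.-tuple R) (r : seq R) (x : R) :
  xi = l :: r :> seq R -> path <%R l r -> last l r = u -> l < u ->
  l <= x <= u ->
  tangent_polyline l u (fun x => x ^+ 2) xi x = envelope l r 1 x.
Proof.
move=> xiE lr rE lu xlu; have sr : size r = n.
  by have := size_tuple xi; rewrite xiE => -[].
rewrite /tangent_polyline.
have -> : l ^+ 2 = tangent l 1 l by rewrite /tangent; ring.
rewrite -{}sr in xi xiE *.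
rewrite (_ : map _ _ = pairmap (fun a b => ((a + b) / 2, a * b)) l r).
  rewrite -{1}rE -{1}rE polyline_envelope//; last by rewrite rE.
  case: r lr rE {xiE xlu xi} lu => [_ <-|b r /= /andP[lb _] _ _].
    by rewrite ltxx.
  by lra.
rewrite -(map_iota_pairmap 0); apply/eq_in_map => i.
rewrite mem_iota => /andP[i1 ir].
have lt_xi : xi`_i.-1 < xi`_i.
  rewrite xiE; case: i i1 ir => // i _ ir.
  by rewrite (@sorted_ltn_nth _ _ lt_trans 0 (l :: r) lr) ?inE//= ltnW.
rewrite tau_square// derive1_square xiE; congr (_, _).
by field.
Qed.

(** The generating set is the cone minus its apex.  Its closed convex hull lies in
the closed convex cone, and it contains the apex, which is the limit of the points
[t * (l, l ^+ 2, 1)] as [t] decreases to 0. *)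
Lemma Ustar_square (R : realType) (n : nat) (l u : R)
    (xi : n.+1.-tuple R) (r : seq R) :
  xi = l :: r :> seq R -> path <%R l r -> last l r = u -> 0 <= l -> l < u ->
  Ustar l u (fun x => x ^+ 2) xi = cut_cone l r :> set (R * R * R).
Proof.
move=> xiE lr rE l0 lu; rewrite /Ustar; set S := [set p | _].
have slope : (u ^+ 2 - l ^+ 2) / (u - l) = l + u.
  by field; apply: lt0r_neq0; lra.
have SE (p : R * R * R) : S p <-> cut_cone l r p /\ 0 < p.2.
  case: p => -[x y] z; rewrite /S /cut_cone /= rE slope.
  have chordE : (l ^+ 2 - (l + u) * l) * z + (l + u) * x =
      (l + u) * x - l * u * z by ring.
  have envE : 0 < z -> l * z <= x <= u * z ->
      z * tangent_polyline l u (fun x => x ^+ 2) xi (x / z)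
      = envelope l r z x.
    move=> z0 xz; rewrite (tangent_polyline_square xiE)//.
      exact: envelope_scale.
    by rewrite ler_pdivlMr// ler_pdivrMr.
  rewrite chordE; split.
    move=> [yI xI /andP[z0 z1] _]; rewrite -envE// z1 (ltW z0).
    by split.
  move=> [[xI /andP[_ z1] yI] z0]; split => //.
  - by rewrite envE.
  - by rewrite z0.
  (* Nonnegativity of y follows from the tangent at l, as l <= x / z and 0 <= l. *)
  have := yI => /andP[+ _]; rewrite envelope_le => /andP[+ _]; apply: le_trans.
  have /andP[lx _] := xI; rewrite /tangent.
  have : l * (l * z) <= l * x by rewrite ler_wpM2l.
  have : 0 <= l * (l * z) by rewrite !mulr_ge0// ltW.
  lra.
apply/seteqP; split => [p|].
  rewrite closureE; apply: smallest_sub; first exact: closed_cut_cone.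
  apply: smallest_sub; first exact: convex_cut_cone.
  by move=> q /SE[].
have Scl q : cut_cone l r q -> 0 < q.2 -> closure (convex_hull S) q.
  move=> Tq q0; apply: (@subset_closure _ (convex_hull S)).
  by apply: sub_gen_smallest; exact: (proj2 (SE q) (conj Tq q0)).
move=> p Tp.
have [p0|] := ltP 0 p.2; first exact: Scl.
case: p Tp => -[x y] z [] /=; rewrite rE => xz /andP[z0 _] yz zle0.
have z00 : z = 0 by apply/le_anti/andP.
have x0 : x = 0 by move: xz; rewrite z00 !mulr0 => /le_anti.
have y0 : y = 0.
  move: yz; rewrite envelope_le z00 x0 /tangent !mulr0 !subrr /=.
  move=> /andP[/andP[+ _]]; rewrite !mulr0 subrr => y_ge0 y_le0.
  exact/le_anti/andP.
rewrite x0 y0 z00 {x y z xz z0 yz zle0 z00 x0 y0}.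
pose ray (t : R) : R^o * R^o * R^o := (t * l, t * l ^+ 2, t).
apply: (@closed_cvg _ _ (0 : R)^'+ _ ray); first exact: closed_closure.
- near=> t; have t0 : 0 < t by [].
  apply: Scl => //; split => /=.
  + by rewrite rE (mulrC t l) lexx ler_wpM2r// ltW.
  + rewrite (ltW t0) /=; near: t; exact: nbhs_right_le.
  + rewrite envelope_le rE; apply/andP; split.
      apply/allP => b _; rewrite /tangent -subr_ge0.
      have -> : t * l ^+ 2 - (2 * b * (t * l) - b ^+ 2 * t) = t * (l - b) ^+ 2.
        by ring.
      by rewrite mulr_ge0 ?sqr_ge0// ltW.
    by rewrite -subr_ge0 (_ : _ - _ = 0)//; ring.
- have t0 : (fun t : R => t) @ (0 : R)^'+ --> (0 : R).
    by apply: cvg_at_right_filter; exact: cvg_id.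
  have t1 : (fun t : R => t * l : R^o) @ (0 : R)^'+ --> (0 : R^o).
    by rewrite -[X in _ --> X](mul0r l); apply: cvgMl.
  have t2 : (fun t : R => t * l ^+ 2 : R^o) @ (0 : R)^'+ --> (0 : R^o).
    by rewrite -[X in _ --> X](mul0r (l ^+ 2)); apply: cvgMl.
  exact: (cvg_pair (cvg_pair t1 t2) t0).
Unshelve. all: by end_near.
Qed.

(** * The minimization *)

Lemma Ustar2_volumeE (R : realType) (n : nat) (l u : R) (xi : n.+1.-tuple R)
    (r : seq R) :
  xi = l :: r :> seq R -> path <%R l r -> last l r = u -> 0 <= l -> l < u ->
  Ustar2_volume l u xi = (1 / 18%:R * (u - l) ^+ 3 + gap_cubes l r / 36%:R)%:E.
Proof.
move=> xiE lr rE l0 lu.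
by rewrite /Ustar2_volume (Ustar_square xiE)// cut_cone_volume// rE.
Qed.

Lemma uniform_subdivision_seq (R : realType) (n : nat) (l u : R) :
  uniform_subdivision n l u =
  l :: [seq l + i%:R * ((u - l) / n%:R) | i <- iota 1 n] :> seq R.
Proof.
rewrite /uniform_subdivision /=.
rewrite (map_comp (fun i : nat => l + i%:R / n%:R * (u - l)) val).
rewrite val_enum_ord /= !mul0r addr0; congr cons.
by apply/eq_map => i; rewrite mulrAC mulrA.
Qed.

Lemma uniform_subdivisionP (R : realType) (n : nat) (l u : R) :
  (0 < n)%N -> l < u -> subdivision l u (uniform_subdivision n l u).
Proof.
move=> n0 lu; rewrite /subdivision uniform_subdivision_seq.
have n0' : n%:R != 0 :> R by rewrite pnatr_eq0 -lt0n.
set r := map _ _; have sr : size r = n by rewrite size_map size_iota.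
have d0 : 0 < (u - l) / n%:R by rewrite divr_gt0 ?subr_gt0 ?ltr0n.
split => //.
  rewrite -[n in _`_n]prednK//= (nth_map 0%N) ?size_iota ?prednK//.
  by rewrite nth_iota ?prednK// add1n prednK// mulrC divfK// addrC subrK.
have : path (fun x y => y == x + (u - l) / n%:R) l r.
  by rewrite path_arith sr.
by apply: sub_path => x y /eqP->; rewrite ltrDl.
Qed.

Theorem theorem3p1 (R : realType) (n : nat) (l u : R)
    (hl : 0 <= l) (hlu : l < u) (hn : (2 <= n)%N) :
  (forall xi : n.+1.-tuple R,
     (subdivision l u xi /\
      forall zeta : n.+1.-tuple R, subdivision l u zeta ->
        (Ustar2_volume l u xi <= Ustar2_volume l u zeta)%E)
     <-> xi = uniform_subdivision n l u)
  /\
  Ustar2_volume l u (uniform_subdivision n l u) =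
    (1 / 18%:R * (u - l) ^+ 3 + (u - l) ^+ 3 / (36%:R * n%:R ^+ 2))%:E.
Proof.
have n0 : (0 < n)%N by exact: ltnW.
pose d := (u - l) / n%:R; pose m := (u - l) ^+ 3 / n%:R ^+ 2.
have n0' : n%:R != 0 :> R by rewrite pnatr_eq0 -lt0n.
have d0 : 0 < d by rewrite divr_gt0 ?subr_gt0 ?ltr0n.
have vol xi : subdivision l u xi -> exists v,
    Ustar2_volume l u xi = (1 / 18%:R * (u - l) ^+ 3 + v / 36%:R)%:E /\
    m <= v ?= iff (xi == uniform_subdivision n l u).
  move=> /subdivisionP[r [xiE lr rE sr]]; exists (gap_cubes l r).
  split; first exact: Ustar2_volumeE.
  have := gap_cubes_leif d0 lr; rewrite path_arith sr rE.
  rewrite -val_eqE /= [val xi]xiE uniform_subdivision_seq eqseq_cons eqxx /=.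
  by congr (_ <= _ ?= iff _); rewrite /m /d; field.
have [vu [volu mu]] := vol _ (uniform_subdivisionP n0 hlu).
have vuE : vu = m by apply/esym/eqP; rewrite mu.
split; last by rewrite volu vuE /m; congr _%:E; field.
move=> xi; split=> [[xiS xi_min]|->].
  have [v [volv mv]] := vol _ xiS.
  have := xi_min _ (uniform_subdivisionP n0 hlu).
  rewrite volv volu vuE lee_fin lerD2l ler_pM2r ?invr_gt0// => vm.
  by apply/eqP; rewrite -mv eq_le vm mv.
split; first exact: uniform_subdivisionP.
move=> zeta /vol[v [-> mv]].
by rewrite volu vuE lee_fin lerD2l ler_pM2r ?invr_gt0// mv.
Qed.
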